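(* Let $G$ be a connected graph with $n$ vertices, diameter $d$ and price function $P$, and label the vertices so that their prices satisfy $p^{1}\le p^{2}\le\cdots\le p^{n}$. Then for every integer $1\le t\le n$, \[ \pi_{P}^{t}(G)\le t\Big[\Big(\prod_{i=n-(d-1)}^{n}p^{i}-1\Big)(n-1)+1\Big]. \]
   Context: A configuration of $k$ pebbles on a graph $G$ is a function $C:V(G)\to\mathbb{Z}_{\ge 0}$ with $\sum_{v}C(v)=k$. A price function is a function $P:V(G)\to\mathbb{Z}_{\ge 2}$. A pebbling move along an edge $v_hv_k$ removes $P(v_h)$ pebbles from $v_h$ and adds one pebble to $v_k$; it is allowed only if the result has no negative values. A configuration $C'$ is derivable from $C$ if it is obtained from $C$ by a finite sequence of pebbling moves. A configuration covers a set of vertices if it is nonzero at each of them. A configuration $C$ is $t$-solvable if for every set of $t$ vertices there is a configuration derivable from $C$ covering that set. For $1\le t\le n$, $\pi_P^t(G)$ is the minimum $k$ such that every configuration of $k$ pebbles on $G$ (with price function $P$) is $t$-solvable. *)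

(* Defs.v *)
From Stdlib Require Export Relation_Operators.
From mathcomp Require Export all_boot.

Set Implicit Arguments.
Unset Strict Implicit.
Unset Printing Implicit Defensive.

(* A finite simple graph is a symmetric irreflexive relation e on a finType. *)

Definition simple_graph (V : finType) (e : rel V) : Prop :=
  symmetric e /\ irreflexive e.

Definition connected_graph (V : finType) (e : rel V) : Prop :=
  0 < #|V| /\ forall x y : V, connect e x y.

Definition walk_of_length (V : finType) (e : rel V) (x y : V) (k : nat) : bool :=
  [exists p : k.-tuple V, path e x p && (last x p == y)].

(* The search stops at #|V|, which loses nothing: connected vertices are joined
   by a path without repeated vertices, hence of length less than #|V|.  The
   junk value #|V| is returned when there is no walk from x to y. *)
Definition dist (V : finType) (e : rel V) (x y : V) : nat :=
  find (walk_of_length e x y) (iota 0 #|V|).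

Definition diameter (V : finType) (e : rel V) : nat :=
  \max_(x : V) \max_(y : V) dist e x y.

Definition config (V : finType) : Type := {ffun V -> nat}.

Definition pebbles (V : finType) (C : config V) : nat := \sum_(v : V) C v.

Definition price_function (V : finType) (P : V -> nat) : Prop :=
  forall v : V, 2 <= P v.

(* C' = C - P u * 1_u + 1_w, with the subtraction moved to the left-hand side.
   The move is allowed exactly when such a C' with values in nat exists. *)
Definition pebbling_move (V : finType) (e : rel V) (P : V -> nat)
    (C C' : config V) : Prop :=
  exists u w : V,
    e u w /\ forall x : V, C' x + P u * (x == u) = C x + (x == w).

Definition derivable (V : finType) (e : rel V) (P : V -> nat) :
    config V -> config V -> Prop :=
  clos_refl_trans (config V) (pebbling_move e P).

Definition covers (V : finType) (C : config V) (S : {set V}) : Prop :=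
  forall v : V, v \in S -> C v != 0.

Definition solvable (V : finType) (e : rel V) (P : V -> nat) (t : nat)
    (C : config V) : Prop :=
  forall S : {set V}, #|S| = t ->
    exists C' : config V, derivable e P C C' /\ covers C' S.

Definition all_solvable (V : finType) (e : rel V) (P : V -> nat) (t k : nat) :
    Prop :=
  forall C : config V, pebbles C = k -> solvable e P t C.

(* k is the t-pebbling number of (V, e) with price function P.  It is a
   predicate because the existence of the minimum has to be proved; the minimum
   is unique when it exists. *)
Definition is_pebbling_number (V : finType) (e : rel V) (P : V -> nat)
    (t k : nat) : Prop :=
  all_solvable e P t k /\ forall j : nat, all_solvable e P t j -> k <= j.

(* Main.v *)
From Stdlib Require Import Classical Wf_nat.
Require Import Defs.
From mathcomp Require Import all_boot.

(* A pebble can be brought from u to v by paying, at u, the product of the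
   prices along a path; as the path repeats no vertex and may be taken of length
   at most d, this costs at most M, the product of the d largest prices.  Among
   (M - 1)(n - 1) + 1 pebbles, either one lies on v already, or M of them share
   a vertex.  Moves are additive in the configuration, so the pebbles spent on
   one target can be set aside while the others are treated. *)

(** Exchange argument against the set [T] of the last [d] indices. The factors common to [A] and [T]
    cancel. Each remaining factor of [A] is at most the smallest value [m] on [T], each remaining
    factor of [T] is at least [m], and [T] has at least as many of them; since [m] is positive, the
    powers of [m] compare. *)
Lemma leq_prod_top (n d : nat) (f : 'I_n -> nat) (A : {set 'I_n}) :
  (forall i, 0 < f i) -> {homo f : i j / i <= j} -> d <= n -> #|A| <= d ->
  \prod_(i in A) f i <= \prod_(i < n | n - d <= i) f i.
Proof.
move=> f_gt0 f_mono le_dn; have [-> | d_gt0 leAd] := posnP d.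
  (* For [d = 0] the pivot index [n - d] would be [n], which is out of range, so this case is
     separate. *)
  rewrite leqn0 => /eqP/cards0_eq->; rewrite big_set0.
  by apply: prodn_gt0.
set T := [set i : 'I_n | n - d <= i].
have cardT : #|T| = d.
  rewrite -sum1_card (eq_bigl (fun i : 'I_n => n - d <= i)) => [|i].
    by rewrite -(big_geq_mkord _ _ predT (fun=> 1)) sum_nat_const_nat muln1 subKn.
  by rewrite inE.
have lt_mn : n - d < n by rewrite ltn_subrL d_gt0 (leq_trans d_gt0).
pose m := f (Ordinal lt_mn).
have -> : \prod_(i < n | n - d <= i) f i = \prod_(i in T) f i.
  by apply: eq_bigl => i; rewrite inE.
rewrite (big_setID T) [X in _ <= X](big_setID A) /= setIC leq_mul2l.
apply/orP; right.
have leDA : \prod_(i in A :\: T) f i <= m ^ #|A :\: T|.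
  rewrite -prod_nat_const; apply: leq_prod => i.
  by rewrite !inE -ltnNge => /andP[/ltnW lt_i _]; apply: f_mono.
have leDT : m ^ #|T :\: A| <= \prod_(i in T :\: A) f i.
  rewrite -prod_nat_const; apply: leq_prod => i.
  by rewrite !inE => /andP[_ le_i]; apply: f_mono.
apply: leq_trans leDA (leq_trans _ leDT).
by rewrite leq_pexp2l ?f_gt0 // !cardsD cardT [T :&: A]setIC leq_sub2r.
Qed.

Section Graph.
Set Implicit Arguments.
Unset Strict Implicit.
Variables (V : finType) (e : rel V).

Lemma dist_le_card (x y : V) : dist e x y <= #|V|.
Proof. by rewrite -[#|V|](size_iota 0) find_size. Qed.

Lemma dist_le_diameter (x y : V) : dist e x y <= diameter e.
Proof.
apply: leq_trans (leq_bigmax x).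
exact: (leq_bigmax (F := fun y => dist e x y) y).
Qed.

Lemma diameter_le_card : diameter e <= #|V|.
Proof.
by apply/bigmax_leqP => x _; apply/bigmax_leqP => y _; apply: dist_le_card.
Qed.

(** A repetition-free path is shorter than [#|V|], so the search in [dist] succeeds and yields a
    walk of length [dist e x y]. Removing repetitions from that walk keeps it within this length and
    lets each price be counted once. *)
Lemma connect_uniq_path (x y : V) :
  connect e x y ->
  exists p, [/\ path e x p, last x p = y, uniq (x :: p) & size p <= dist e x y].
Proof.
move=> /connectP[p0 /shortenP[p p_path p_uniq _] y_last].
have lt_p : size p < #|V|.
  by rewrite -[(size p).+1]/(size (x :: p)) -(card_uniqP p_uniq) max_card.
have has_walk : has (walk_of_length e x y) (iota 0 #|V|).
  apply/hasP; exists (size p); first by rewrite mem_iota.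
  by apply/existsP; exists (in_tuple p); rewrite p_path y_last eqxx.
have := nth_find 0 has_walk.
rewrite nth_iota; last by rewrite -[X in _ < X](size_iota 0) -has_find.
move=> /existsP[q /andP[q_path /eqP q_last]].
case/shortenP: q_path q_last => q' q'_path q'_uniq q'_sub q'_last.
exists q'; split=> //; rewrite -[X in _ <= X](size_tuple q).
by apply: uniq_leq_size => //; case/andP: q'_uniq.
Qed.

End Graph.

Section Pebbling.
Set Implicit Arguments.
Unset Strict Implicit.
Variables (V : finType) (e : rel V) (P : V -> nat).

Definition addc (C D : config V) : config V := [ffun x => C x + D x].

Definition stack (u : V) (k : nat) : config V := [ffun x => k * (x == u)].

Lemma pebbles_addc (C D : config V) :
  pebbles (addc C D) = pebbles C + pebbles D.
Proof. by rewrite -big_split; apply: eq_bigr => x _; rewrite ffunE. Qed.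

Lemma pebbles_stack (u : V) (k : nat) : pebbles (stack u k) = k.
Proof.
rewrite /pebbles (bigD1 u) //= ffunE eqxx muln1 big1 ?addn0 // => x.
by rewrite ffunE => /negPf->; rewrite muln0.
Qed.

Lemma addcC (C D : config V) : addc C D = addc D C.
Proof. by apply/ffunP => x; rewrite !ffunE addnC. Qed.

Lemma stackD (u : V) (k l : nat) :
  stack u (k + l) = addc (stack u k) (stack u l).
Proof. by apply/ffunP => x; rewrite !ffunE mulnDl. Qed.

Lemma stack_split (C : config V) (u : V) (k : nat) :
  k <= C u -> exists D, C = addc (stack u k) D.
Proof.
move=> le_k; exists [ffun x => C x - k * (x == u)]; apply/ffunP => x.
rewrite !ffunE subnKC //.
by have [-> | _] := eqVneq; rewrite ?muln1 ?muln0.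
Qed.

Lemma derivable_trans (C1 C2 C3 : config V) :
  derivable e P C1 C2 -> derivable e P C2 C3 -> derivable e P C1 C3.
Proof. exact: rt_trans. Qed.

Lemma derivable_addr (C C' D : config V) :
  derivable e P C C' -> derivable e P (addc C D) (addc C' D).
Proof.
elim=> [C1 C2 [u [w [uw moveC]]] | C1 | C1 C2 C3 _ IH1 _ IH2].
- apply: rt_step; exists u, w; split=> // x.
  by rewrite !ffunE addnAC moveC addnAC.
- exact: rt_refl.
- exact: rt_trans IH1 IH2.
Qed.

Lemma derivable_addc (C C' D D' : config V) :
  derivable e P C C' -> derivable e P D D' ->
  derivable e P (addc C D) (addc C' D').
Proof.
move=> derC derD; apply: derivable_trans (derivable_addr D derC) _.
by rewrite ![addc C' _]addcC; apply: derivable_addr.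
Qed.

Lemma derivable_edge (u w : V) (k : nat) :
  e u w -> derivable e P (stack u (P u * k)) (stack w k).
Proof.
move=> uw; elim: k => [|k IHk].
  suff ->: stack u (P u * 0) = stack w 0 by apply: rt_refl.
  by apply/ffunP => x; rewrite !ffunE muln0.
rewrite mulnS -[k.+1]add1n !stackD; apply: derivable_addc IHk.
apply: rt_step; exists u, w; split=> // x.
by rewrite !ffunE mul1n addnC.
Qed.

(** Every vertex of the path except the last is left by a move and charges its price, hence the
    product over [belast u p]. *)
Lemma derivable_path (u : V) (p : seq V) (k : nat) :
  path e u p ->
  derivable e P (stack u ((\prod_(x <- belast u p) P x) * k))
                (stack (last u p) k).
Proof.
elim: p u => [|w p IHp] u /=; first by rewrite big_nil mul1n => _; apply: rt_refl.
case/andP=> uw w_path; rewrite big_cons -mulnA.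
exact: derivable_trans (derivable_edge _ uw) (IHp w w_path).
Qed.

Lemma solve_one (M : nat) (v : V) (C : config V) :
  (forall u, exists k, k <= M /\ derivable e P (stack u k) (stack v 1)) ->
  0 < M -> (M - 1) * (#|V| - 1) + 1 <= pebbles C ->
  exists u k D, [/\ C = addc (stack u k) D, k <= (M - 1) * (#|V| - 1) + 1
                  & derivable e P (stack u k) (stack v 1)].
Proof.
move=> reach M_gt0 leC; have [Cv0 | Cv_gt0] := posnP (C v); last first.
  have [D defC] := stack_split Cv_gt0.
  by exists v, 1, D; split=> //; [rewrite addn1 | apply: rt_refl].
(* Pigeonhole: otherwise the [#|V| - 1] vertices other than [v] hold at most [M - 1] pebbles each,
   and [v] holds none. *)
have [u /andP[u_v leMu]] : exists u, (u != v) && (M <= C u).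
  apply/existsP; apply: contraLR leC; rewrite negb_exists -ltnNge => /forallP small.
  rewrite addn1 ltnS /pebbles (bigD1 v) //= Cv0 add0n mulnC.
  rewrite subn1 -(cardC1 v) -sum_nat_const.
  apply: leq_sum => x x_v; have := small x.
  by rewrite x_v -ltnNge -{1}(subnK M_gt0) addn1 ltnS.
have [k [le_kM der_k]] := reach u.
have [D defC] := stack_split (leq_trans le_kM leMu).
exists u, k, D; split=> //; apply: leq_trans le_kM _.
(* With a single vertex the bound would be 1, possibly below [M]; the distinct vertices [u] and [v]
   exclude this. *)
have card_gt1 : 1 < #|V| by apply/card_gt1P; exists u, v.
by rewrite -{1}(subnK M_gt0) leq_add2r leq_pmulr // subn_gt0.
Qed.

(** Induction on the size of [S]: one target uses up at most one of the [#|S|] equal shares of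
    pebbles, so the untouched rest [D] still suffices for the other targets. *)
Lemma solve_set (M : nat) (S : {set V}) (C : config V) :
  (forall u v, exists k, k <= M /\ derivable e P (stack u k) (stack v 1)) ->
  0 < M -> #|S| * ((M - 1) * (#|V| - 1) + 1) <= pebbles C ->
  exists C', derivable e P C C' /\ covers C' S.
Proof.
move=> reach M_gt0; move cardS: #|S| => t; elim: t S cardS C => [|t IHt] S cardS C leC.
  by exists C; split=> [|v]; [apply: rt_refl | rewrite (cards0_eq cardS) inE].
have [v vS] : exists v, v \in S by apply/card_gt0P; rewrite cardS.
have cardSv : #|S :\ v| = t by move: cardS; rewrite (cardsD1 v) vS => -[].
rewrite mulSn in leC.
have [u [k [D [defC le_k der_k]]]] :=
  solve_one (reach^~ v) M_gt0 (leq_trans (leq_addr _ _) leC).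
have leD : t * ((M - 1) * (#|V| - 1) + 1) <= pebbles D.
  move: leC; rewrite defC pebbles_addc pebbles_stack => leC.
  by rewrite -(leq_add2l k) (leq_trans _ leC) // leq_add2r.
have [D' [derD covD]] := IHt _ cardSv D leD.
exists (addc (stack v 1) D'); split; first by rewrite defC; apply: derivable_addc.
move=> x xS; rewrite !ffunE addn_eq0 negb_and.
have [// | x_v] := eqVneq x v.
by rewrite covD ?orbT // !inE x_v.
Qed.

End Pebbling.

Theorem theorem10 (V : finType) (e : rel V) (P : V -> nat) (n d t : nat)
    (label : 'I_n -> V) :
  simple_graph e ->
  connected_graph e ->
  #|V| = n ->
  diameter e = d ->
  price_function P ->
  bijective label ->
  (forall i j : 'I_n, i <= j -> P (label i) <= P (label j)) ->
  1 <= t <= n ->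
  exists k : nat,
    is_pebbling_number e P t k /\
    k <= t * ((\prod_(i < n | n - d <= i) P (label i) - 1) * (n - 1) + 1).
Proof.
move=> _ [_ conn] cardV diam price label_bij label_mono _.
have P_gt0 v : 0 < P v by apply: leq_trans (price v).
set M := \prod_(i < n | _) _.
have M_gt0 : 0 < M by apply: prodn_gt0.
have reach u v : exists k, k <= M /\ derivable e P (stack u k) (stack v 1).
  have [p [p_path <- p_uniq le_p]] := connect_uniq_path (conn u v).
  exists (\prod_(x <- belast u p) P x); split; last first.
    by rewrite -[X in stack u X]muln1; apply: derivable_path.
  have belast_uniq : uniq (belast u p).
    by move: p_uniq; rewrite lastI rcons_uniq => /andP[].
  rewrite big_uniq //= (reindex label) /=; last exact: onW_bij.
  (* The cost of the path becomes a product over a set of labels, with at most [d] elements since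
     [belast u p] is as long as [p]. *)
  pose A := [set i | label i \in belast u p].
  rewrite (eq_bigl [in A]) => [|i]; last by rewrite inE.
  apply: leq_prod_top => //; first by rewrite -diam -cardV diameter_le_card.
  rewrite -(card_imset _ (bij_inj label_bij)) -diam.
  apply: leq_trans _ (leq_trans le_p (dist_le_diameter e u _)).
  rewrite -(size_belast u p) -(card_uniqP belast_uniq); apply: subset_leq_card.
  by apply/subsetP => _ /imsetP[i + ->]; rewrite inE.
have bound_ok : all_solvable e P t (t * ((M - 1) * (n - 1) + 1)).
  by move=> C sizeC S cardS; apply: (solve_set reach); rewrite ?cardS ?cardV ?sizeC.
(* The bound shows that some [k] is admissible; excluded middle replaces a decision procedure for
   [all_solvable] in extracting the least one. *)
have [k [[k_ok k_min] _]] := dec_inh_nat_subset_has_unique_least_element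
  (all_solvable e P t) (fun j => classic _) (ex_intro _ _ bound_ok).
exists k; split; last by apply/leP/k_min.
by split=> // j j_ok; apply/leP/k_min.
Qed.
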